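(* Let $\mathcal{K}\subseteq\mathbb{R}^n$ be a pointed closed convex cone. (i) If the set of extreme rays of $\mathcal{K}$ is countable, then $$\kappa(\mathcal{K})=\ell_{\mathcal{K}}-1=\dim\mathcal{K}.$$ In particular, these equalities hold when $\mathcal{K}$ is polyhedral. (ii) If $\mathcal{K}$ is a strictly convex cone with $\dim\mathcal{K}\geq 2$, then $$\kappa(\mathcal{K})=\ell_{\mathcal{K}}-1=2.$$
   Context: A closed convex cone $\mathcal{K}\subseteq\mathbb{R}^n$ is pointed if $\mathcal{K}\cap-\mathcal{K}=\{0\}$. A convex subset $\mathcal{F}\subseteq\mathcal{K}$ is a face of $\mathcal{K}$ if, whenever $x,y\in\mathcal{K}$ and $\alpha x+(1-\alpha)y\in\mathcal{F}$ for some $0<\alpha<1$, then $x,y\in\mathcal{F}$. An extreme ray is a one-dimensional face. For $S\subseteq\mathcal{K}$, $\mathcal{F}(S,\mathcal{K})$ denotes the minimal face of $\mathcal{K}$ containing $S$. ''Countable'' includes finite. For $x\in\mathcal{K}$, $\kappa(x)$ is the smallest nonnegative integer $k$ such that $x=d_1+\cdots+d_k$ with each $d_i$ belonging to an extreme ray of $\mathcal{K}$ (the empty sum is $0$), and $\kappa(\mathcal{K})=\max\{\kappa(x)\mid x\in\mathcal{K}\}$. A chain of faces of $\mathcal{K}$ is a finite sequence $\mathcal{F}_1\supsetneq\cdots\supsetneq\mathcal{F}_\ell$ of nonempty faces of $\mathcal{K}$, each properly containing the next; its length is the number $\ell$ of faces. $\ell_{\mathcal{K}}$ is the length of the longest chain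 of faces of $\mathcal{K}$. A pointed closed convex cone $\mathcal{K}$ is strictly convex if $\mathrm{int}\,\mathcal{K}\neq\emptyset$ and $\mathcal{F}(\{x,y\},\mathcal{K})=\mathcal{K}$ for every pair of linearly independent $x,y\in\mathrm{bd}\,\mathcal{K}$, where $\mathrm{bd}\,\mathcal{K}=\mathcal{K}\setminus\mathrm{ri}\,\mathcal{K}$ is the relative boundary. *)

(* Defs.v *)
(* MathComp-Analysis; R^n is the type 'rV[R]_n with its normed topology. *)
From HB Require Import structures.
From mathcomp Require Import all_boot all_order all_algebra.
From mathcomp Require Import all_classical all_reals all_analysis.

Set Implicit Arguments.
Unset Strict Implicit.
Unset Printing Implicit Defensive.

Import Order.TTheory GRing.Theory Num.Theory.
Import numFieldNormedType.Exports.

Local Open Scope classical_set_scope.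
Local Open Scope ring_scope.

Definition closed_convex_cone (R : realType) (n : nat) (K : set 'rV[R]_n) : Prop :=
  [/\ K !=set0, closed K, @convex_set R 'rV[R]_n K &
      forall (t : R) x, 0 <= t -> K x -> K (t *: x)].

Definition pointed_cone (R : realType) (n : nat) (K : set 'rV[R]_n) : Prop :=
  K `&` [set - x | x in K] = [set 0].

(* The empty set counts as a face. *)
Definition face (R : realType) (n : nat) (K F : set 'rV[R]_n) : Prop :=
  [/\ F `<=` K, @convex_set R 'rV[R]_n F &
      forall (x y : 'rV[R]_n) (a : R), K x -> K y -> 0 < a < 1 ->
        F (a *: x + (1 - a) *: y) -> F x /\ F y].

Definition minimal_face (R : realType) (n : nat) (S K : set 'rV[R]_n) :
    set 'rV[R]_n :=
  smallest (face K) S.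

Definition affine_set (R : realType) (n : nat) (A : set 'rV[R]_n) : Prop :=
  forall (x y : 'rV[R]_n) (t : R), A x -> A y -> A (t *: x + (1 - t) *: y).

Definition affine_hull (R : realType) (n : nat) (S : set 'rV[R]_n) :
    set 'rV[R]_n :=
  smallest (@affine_set R n) S.

Definition is_direction (R : realType) (n : nat) (S : set 'rV[R]_n)
    (V : {vspace 'rV[R]_n}) : Prop :=
  exists x0 : 'rV[R]_n, affine_hull S = [set x0 + v | v in [set` V]].

(* A nonempty S has exactly one direction space. The empty set has none and
   gets dimension 0, so a set of dimension 1 is never empty. *)
Definition aff_dim (R : realType) (n : nat) (S : set 'rV[R]_n) : nat :=
  \dim (xget 0%VS (is_direction S)).

Definition extreme_ray (R : realType) (n : nat) (K F : set 'rV[R]_n) : Prop :=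
  face K F /\ aff_dim F = 1%N.

Definition sum_of_extreme (R : realType) (n : nat) (K : set 'rV[R]_n)
    (x : 'rV[R]_n) (k : nat) : Prop :=
  exists d : 'I_k -> 'rV[R]_n,
    (forall i, exists2 F, extreme_ray K F & F (d i)) /\ x = \sum_(i < k) d i.

(* is_kappa_at K x k reads: kappa(x) is defined and equal to k. *)
Definition is_kappa_at (R : realType) (n : nat) (K : set 'rV[R]_n)
    (x : 'rV[R]_n) (k : nat) : Prop :=
  sum_of_extreme K x k /\ forall j, sum_of_extreme K x j -> (k <= j)%N.

(* is_kappa K m reads: kappa(x) is defined for every x in K, and m is the
   maximum, attained, of these values. *)
Definition is_kappa (R : realType) (n : nat) (K : set 'rV[R]_n) (m : nat) : Prop :=
  (forall x, K x -> exists2 k, is_kappa_at K x k & (k <= m)%N) /\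
  (exists2 x, K x & is_kappa_at K x m).

Definition face_chain (R : realType) (n : nat) (K : set 'rV[R]_n)
    (l : nat) (F : nat -> set 'rV[R]_n) : Prop :=
  (forall i, (i < l)%N -> face K (F i) /\ F i !=set0) /\
  (forall i, (i.+1 < l)%N -> F i.+1 `<` F i).

Definition is_longest_chain_length (R : realType) (n : nat) (K : set 'rV[R]_n)
    (l : nat) : Prop :=
  (exists F, face_chain K l F) /\
  (forall l' F, face_chain K l' F -> (l' <= l)%N).

(* Finite intersection of closed half-spaces. *)
Definition polyhedral (R : realType) (n : nat) (K : set 'rV[R]_n) : Prop :=
  exists (m : nat) (A : 'M[R]_(m, n)) (b : 'cV[R]_m),
    K = [set x : 'rV[R]_n | forall i, (A *m x^T) i 0 <= b i 0].

Definition rel_interior (R : realType) (n : nat) (K : set 'rV[R]_n) :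
    set 'rV[R]_n :=
  [set x | K x /\ \forall y \near x, affine_hull K y -> K y].

Definition rel_boundary (R : realType) (n : nat) (K : set 'rV[R]_n) :
    set 'rV[R]_n :=
  K `\` rel_interior K.

Definition strictly_convex_cone (R : realType) (n : nat) (K : set 'rV[R]_n) :
    Prop :=
  [/\ closed_convex_cone K, pointed_cone K, interior K !=set0 &
      forall x y, rel_boundary K x -> rel_boundary K y -> free [:: x; y] ->
        minimal_face [set x; y] K = K].

(* Main.v *)
Require Import Defs.
From HB Require Import structures.
From mathcomp Require Import all_boot all_order all_algebra.
From mathcomp Require Import all_classical all_reals all_analysis.
From mathcomp Require Import ring lra zify.

Set Implicit Arguments.
Unset Strict Implicit.
Unset Printing Implicit Defensive.

Import Order.TTheory GRing.Theory Num.Theory.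
Import numFieldNormedType.Exports.

Local Open Scope classical_set_scope.
Local Open Scope ring_scope.

(** The idea: a longest chain of faces, a shortest decomposition into extreme
    rays and the dimension are compared through one greedy descent.

    Upper bounds.  A nonempty face of a convex cone is the intersection of the
    cone with the linear span of the face ([face_lspan]), so a strict inclusion
    of faces is a strict inclusion of spans, and a chain starting at a face F
    has length at most dim F + 1 ([face_chain_dim]).  Conversely, given x <> 0
    in K, the minimal face of x contains an extreme ray through some d; moving
    from x in the direction - d until K is left ends at a point x' = x - t d
    whose minimal face does not contain d ([max_step]; this is where closedness
    and pointedness enter).  Repeating with x' writes x as a sum of j elements
    of extreme rays and at the same time produces a chain of j + 1 faces
    ([extreme_decomposition_chain]).  Hence kappa(x) <= l_K - 1, and it is enough
    to find a bound m + 1 on the length of all chains together with one point of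
    K that is not a sum of fewer than m elements of extreme rays
    ([kappa_longest_chain]).

    Countably many rays.  With d = dim K, chains have length at most d + 1.  The
    points that are sums of fewer than d elements of extreme rays lie in
    countably many subspaces of dimension < d.  The moment curve
    t |-> e_0 + t e_1 + ... + t^(d-1) e_(d-1) built on a basis of the span of K
    taken in K stays in K for t >= 0 and meets each such subspace for finitely
    many t only, so an uncountable interval of parameters cannot be exhausted
    ([moment_curve_avoids], [kappa_countable]).  In a polyhedral cone an extreme
    ray is determined by the inequalities that are tight on it, so there are
    finitely many ([countable_extreme_rays_polyhedral]).

    Strictly convex cones.  A proper face consists of boundary points, so two
    independent elements of it would generate K; it therefore lies on a line
    ([proper_face_line]) and chains have length at most 3.  An interior point
    generates K, so it lies on no extreme ray as soon as dim K >= 2, and it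
    needs two summands ([kappa_strictly_convex]). *)

(** * Linear span and affine dimension *)

Section LinearSpan.
Variables (R : realType) (n : nat).
Implicit Types (S : set 'rV[R]_n) (x y : 'rV[R]_n) (V : {vspace 'rV[R]_n}).

(** A linearly independent sequence of maximal length in [S] spans [S]. *)
Lemma span_basis_in S : exists X : seq 'rV[R]_n,
  [/\ {in X, forall x, S x}, free X & forall x, S x -> x \in <<X>>%VS].
Proof.
pose P k := `[< exists X : seq 'rV[R]_n,
  [/\ {in X, forall x, S x}, free X & size X = k] >].
have P0 : exists k, P k.
  by exists 0%N; apply/asboolP; exists [::]; split => //; rewrite nil_free.
have Pmax k : P k -> (k <= \dim {:'rV[R]_n})%N.
  move=> /asboolP[X [_ fX <-]]; rewrite -(eqP fX).
  exact/dimvS/subvf.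
case: (ex_maxnP P0 Pmax) => k /asboolP[X [XS fX sX]] kmax.
exists X; split => // x Sx; apply/negPn/negP => xX.
suff : (k.+1 <= k)%N by rewrite ltnn.
apply: kmax; apply/asboolP; exists (x :: X); split; last by rewrite /= sX.
- by move=> y; rewrite inE => /orP[/eqP -> //|]; apply: XS.
- by rewrite free_cons xX.
Qed.

Definition lspan S : {vspace 'rV[R]_n} := <<projT1 (cid (span_basis_in S))>>%VS.

Lemma lspan_basis S : exists X : seq 'rV[R]_n,
  [/\ {in X, forall x, S x}, free X & lspan S = <<X>>%VS].
Proof.
by rewrite /lspan; case: cid => X [XS fX SX] /=; exists X.
Qed.

Lemma mem_lspan S x : S x -> x \in lspan S.
Proof. by rewrite /lspan; case: cid => X [XS fX SX] /=; apply: SX. Qed.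

Lemma lspan_sub S V : (forall x, S x -> x \in V) -> (lspan S <= V)%VS.
Proof.
move=> SV; have [X [XS _ ->]] := lspan_basis S.
by apply/span_subvP => x /XS /SV.
Qed.

Lemma lspanS S1 S2 : S1 `<=` S2 -> (lspan S1 <= lspan S2)%VS.
Proof. by move=> S12; apply: lspan_sub => x /S12; apply: mem_lspan. Qed.

(** An affine set through 0 is closed under scaling, hence under sums, because
    y + z is the midpoint of 2 y and 2 z. *)
Lemma affine_hullE S : S 0 -> affine_hull S = [set` lspan S].
Proof.
move=> S0; apply/seteqP; split.
  apply: smallest_sub => [x y t /= xV yV|x Sx /=]; last exact: mem_lspan.
  by rewrite rpredD // rpredZ.
move=> x /= xV A [Aaff SA].
have A0 : A 0 by apply: SA.
have AZ t y : A y -> A (t *: y).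
  by move=> Ay; have := Aaff _ _ t Ay A0; rewrite scaler0 addr0.
have AD y z : A y -> A z -> A (y + z).
  move=> Ay Az; have := Aaff _ _ 2^-1 (AZ 2 _ Ay) (AZ 2 _ Az).
  have half1 : 2^-1 * 2 = 1 :> R by field.
  have half2 : (1 - 2^-1) * 2 = 1 :> R by field.
  by rewrite !scalerA half1 half2 !scale1r.
have [X [XS _ XV]] := lspan_basis S.
move: xV; rewrite XV => /(@coord_span _ _ _ (in_tuple X)) ->.
apply: (big_ind A) => // i _; apply/AZ/SA/XS; exact/mem_nth.
Qed.

(** [is_direction] leaves the base point free, but a translate of a subspace that
    is itself a subspace is equal to it, so the direction is unique. *)
Lemma aff_dimE S : S 0 -> aff_dim S = \dim (lspan S).
Proof.
move=> S0; rewrite /aff_dim; congr (\dim _).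
apply: xget_unique.
  exists 0; rewrite affine_hullE //.
  by apply/seteqP; split=> [x xV|_ [x xV <-]]; [exists x => //|]; rewrite add0r.
move=> V [x0]; rewrite affine_hullE // => hV.
have x0V : x0 \in V.
  have : [set` lspan S] 0 by rewrite /= mem0v.
  rewrite hV => -[v /= vV /(canRL (addKr _))]; rewrite addr0 => vE.
  by rewrite -memvN -vE.
apply/vspaceP => x; apply/idP/idP => xV.
  have : [set` lspan S] x.
    by rewrite hV; exists (x - x0); rewrite /= ?rpredB // subrKC.
  by [].
have : [set` lspan S] x by [].
by rewrite hV => -[v vV <-]; rewrite rpredD.
Qed.

Lemma lspan_sub_line S x : x != 0 -> S x -> S `<=` [set` <[x]>%VS] ->
  \dim (lspan S) = 1%N.
Proof.
move=> x0 Sx Sl.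
suff -> : lspan S = <[x]>%VS by rewrite dim_vline x0.
by apply/eqP; rewrite eqEsubv -memvE mem_lspan // andbT; apply: lspan_sub.
Qed.

End LinearSpan.

(** * Faces of a cone and their spans *)

Section ConvexSets.
Variables (R : realType) (n : nat).
Implicit Types (S : set 'rV[R]_n) (x y : 'rV[R]_n).

Lemma convex_setP S : @convex_set R 'rV[R]_n S <->
  forall x y (a : R), S x -> S y -> 0 <= a <= 1 -> S (a *: x + (1 - a) *: y).
Proof.
split=> [cS x y a Sx Sy /andP[a0 a1]|cS x y l /set_mem Sx /set_mem Sy].
  exact/set_mem/(cS x y (Itv01 a0 a1) (mem_set Sx) (mem_set Sy)).
by apply/mem_set/cS => //; apply/andP.
Qed.

End ConvexSets.

Section Cones.
Variables (R : realType) (n : nat) (K : set 'rV[R]_n).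
Hypothesis hK : closed_convex_cone K.
Hypothesis hp : pointed_cone K.
Implicit Types (F : set 'rV[R]_n) (x y z : 'rV[R]_n).

Lemma coneZ (t : R) x : 0 <= t -> K x -> K (t *: x).
Proof. by case: hK => _ _ _; apply. Qed.

Lemma cone0 : K 0.
Proof. by case: hK => [[x Kx]] _ _ _; rewrite -(scale0r x); apply: coneZ. Qed.

Lemma coneD x y : K x -> K y -> K (x + y).
Proof.
move=> Kx Ky; case: hK => _ _ /convex_setP cK _.
have h : 0 <= (2^-1 : R) <= 1 by lra.
have half1 : 2 * 2^-1 = 1 :> R by field.
have half2 : 2 * (1 - 2^-1) = 1 :> R by field.
have := coneZ (ler0n _ 2) (cK _ _ _ Kx Ky h).
by rewrite scalerDr !scalerA half1 half2 !scale1r.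
Qed.

Lemma cone_pointed x : K x -> K (- x) -> x = 0.
Proof.
move=> Kx Kx'; suff : (K `&` [set - x | x in K]) x by rewrite hp.
by split => //; exists (- x); rewrite ?opprK.
Qed.

Section Face.
Variable F : set 'rV[R]_n.
Hypotheses (fF : face K F) (F0 : F !=set0).

Lemma face0 : F 0.
Proof.
have [FK _ Fe] := fF; have [x Fx] := F0.
have h : 0 < (2^-1 : R) < 1 by lra.
have half : (1 - 2^-1) * 2 = 1 :> R by field.
by have [] := Fe 0 (2 *: x) _ cone0 (coneZ (ler0n _ 2) (FK _ Fx)) h;
  rewrite // scaler0 add0r scalerA half scale1r.
Qed.

Lemma faceZ (t : R) x : 0 <= t -> F x -> F (t *: x).
Proof.
move=> t0 Fx; have [FK /convex_setP cF Fe] := fF.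
have t1 : 0 < t + 1 by lra.
have t2 : 0 < t + 2 by lra.
(* x lies strictly between 0 and (t + 2) x *)
have h : 0 < (t + 2)^-1 < 1 by rewrite invr_gt0 t2 invf_lt1 //; lra.
have [] := Fe ((t + 2) *: x) 0 _ (coneZ (ltW t2) (FK _ Fx)) cone0 h.
  by rewrite scaler0 addr0 scalerA mulVf ?gt_eqF // scale1r.
move=> Fx' _; have h' : 0 <= t / (t + 2) <= 1.
  by rewrite divr_ge0 ?(ltW t2) // ler_pdivrMr //; lra.
have := cF _ _ _ Fx' face0 h'.
by rewrite scaler0 addr0 scalerA divfK ?gt_eqF.
Qed.

Lemma faceD x y : F x -> F y -> F (x + y).
Proof.
move=> Fx Fy; have [FK /convex_setP cF Fe] := fF.
have h : 0 <= (2^-1 : R) <= 1 by lra.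
have half1 : 2 * 2^-1 = 1 :> R by field.
have half2 : 2 * (1 - 2^-1) = 1 :> R by field.
have := faceZ (ler0n _ 2) (cF _ _ _ Fx Fy h).
by rewrite scalerDr !scalerA half1 half2 !scale1r.
Qed.

(** The face property in additive form: x + y is the midpoint of 2 x and 2 y. *)
Lemma face_summand x y : K x -> K y -> F (x + y) -> F x.
Proof.
move=> Kx Ky Fxy; have [FK _ Fe] := fF.
have h : 0 < (2^-1 : R) < 1 by lra.
have half1 : 2^-1 * 2 = 1 :> R by field.
have half2 : (1 - 2^-1) * 2 = 1 :> R by field.
have [] := Fe (2 *: x) (2 *: y) _ (coneZ (ler0n _ 2) Kx) (coneZ (ler0n _ 2) Ky) h.
  by rewrite !scalerA half1 half2 !scale1r.
move=> F2x _; have := faceZ (ltW (proj1 (andP h))) F2x.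
by rewrite scalerA half1 scale1r.
Qed.

Lemma face_sum (I : Type) (r : seq I) (P : pred I) (f : I -> 'rV[R]_n) :
  (forall i, P i -> F (f i)) -> F (\sum_(i <- r | P i) f i).
Proof. by move=> Ff; apply: big_ind Ff; [exact: face0|exact: faceD]. Qed.

(** If z is a linear combination of elements x_i of [F] with coefficients c_i,
    then adding w = sum |c_i| x_i, which lies in [F], makes all coefficients
    nonnegative.  So z + w lies in [F], and its summand z does too. *)
Lemma face_lspan z : K z -> z \in lspan F -> F z.
Proof.
move=> Kz zF; have [X [XF _ XE]] := lspan_basis F.
move: zF; rewrite XE => /(@coord_span _ _ _ (in_tuple X)).
set c := coord _ => zE.
have FX (i : 'I_(size X)) : F (X`_i) by apply/XF/mem_nth.
have FK : F `<=` K by case: fF.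
pose w := \sum_i `|c i z| *: X`_i.
have Fw : F w by apply: face_sum => i _; apply: faceZ.
apply: (face_summand Kz (FK _ Fw)); rewrite zE /w -big_split /=.
apply: face_sum => i _; rewrite -scalerDl; apply: faceZ => //.
by rewrite -lerBlDl sub0r -normrN ler_norm.
Qed.

End Face.

Lemma dim_face_lt F1 F2 : face K F1 -> F1 !=set0 -> face K F2 ->
  F1 `<` F2 -> (\dim (lspan F1) < \dim (lspan F2))%N.
Proof.
move=> fF1 F10 [F2K _ _] [F12 F21].
rewrite (ltn_leqif (dimv_leqif_sup (lspanS F12))); apply/negP => sF.
apply: F21 => z F2z; apply: (face_lspan fF1 F10); first exact: F2K.
exact: (subvP sF) _ (mem_lspan F2z).
Qed.

(** * The face generated by a point *)

(** The minimal face of [K] containing [x], for [x] in [K], described by the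
    directions in which one can move backwards from [x]; [gen_face_face],
    [gen_face_refl] and [gen_face_min] show that it is that face. *)
Definition gen_face x : set 'rV[R]_n :=
  [set y | K y /\ exists2 e : R, 0 < e & K (x - e *: y)].

(** x - e' y is a convex combination of x - e y and x. *)
Lemma gen_face_shrink x y (e e' : R) : K x -> 0 <= e' <= e -> 0 < e ->
  K (x - e *: y) -> K (x - e' *: y).
Proof.
move=> Kx /andP[e'0 e'e] e0 Ke.
have -> : x - e' *: y = (e' / e) *: (x - e *: y) + (1 - e' / e) *: x.
  rewrite scalerBr scalerA divfK ?gt_eqF // scalerBl scale1r.
  by rewrite [RHS]addrC addrA subrK.
apply: coneD; apply: coneZ => //; first by rewrite divr_ge0 // ltW.
by rewrite subr_ge0 ler_pdivrMr // mul1r.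
Qed.

Lemma gen_face_refl x : K x -> gen_face x x.
Proof.
move=> Kx; split=> //; exists 1 => //; rewrite scale1r subrr; exact: cone0.
Qed.

Lemma gen_face_min F x : face K F -> F x -> gen_face x `<=` F.
Proof.
move=> fF Fx y [Ky [e e0 Ke]]; have F0 : F !=set0 by exists x.
have Fey : F (e *: y).
  apply: (face_summand fF F0 (coneZ (ltW e0) Ky) Ke).
  by rewrite addrC subrK.
have : F (e^-1 *: (e *: y)) by apply: faceZ => //; rewrite invr_ge0 ltW.
by rewrite scalerA mulVf ?gt_eqF // scale1r.
Qed.

Lemma gen_faceD x y z : K x -> gen_face x y -> gen_face x z -> gen_face x (y + z).
Proof.
move=> Kx [Ky [e e0 Ke]] [Kz [f f0 Kf]]; split; first exact: coneD.
pose g := Num.min e f; have g0 : 0 < g by rewrite lt_min e0.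
exists (g / 2); first by rewrite divr_gt0.
have -> : x - (g / 2) *: (y + z) = 2^-1 *: ((x - g *: y) + (x - g *: z)).
  rewrite addrACA -opprD -scalerDr scalerBr scalerA [_^-1 * g]mulrC.
  have -> : x + x = 2 *: x by rewrite scaler_nat mulr2n.
  by rewrite scalerA mulVf ?pnatr_eq0 // scale1r.
apply/coneZ/coneD; first by rewrite invr_ge0 ler0n.
  by apply: gen_face_shrink Ke => //; rewrite ltW //= ge_min lexx.
by apply: gen_face_shrink Kf => //; rewrite ltW //= ge_min lexx orbT.
Qed.

Lemma gen_faceZ x y (t : R) : K x -> 0 <= t -> gen_face x y -> gen_face x (t *: y).
Proof.
move=> Kx; rewrite le0r => /orP[/eqP -> _|t0 [Ky [e e0 Ke]]].
  rewrite scale0r; split; first exact: cone0.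
  by exists 1 => //; rewrite scaler0 subr0.
split; first exact: coneZ (ltW t0) Ky.
exists (e / t); first by rewrite divr_gt0.
by rewrite scalerA divfK ?gt_eqF.
Qed.

Lemma gen_face_face x : K x -> face K (gen_face x).
Proof.
move=> Kx; split=> [y []//||y z a Ky Kz /andP[a0 a1] [_ [e e0 Ke]]].
  apply/convex_setP => y z a Gy Gz /andP[a0 a1].
  by apply: gen_faceD => //; apply: gen_faceZ => //; rewrite subr_ge0.
have a1' : 0 < 1 - a by rewrite subr_gt0.
split; split=> //.
  exists (e * a); first exact: mulr_gt0.
  rewrite (_ : _ - _ = (x - e *: (a *: y + (1 - a) *: z)) + (e * (1 - a)) *: z).
    by apply/coneD/coneZ => //; rewrite mulr_ge0 // ltW.
  by rewrite scalerDr !scalerA opprD addrA subrK.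
exists (e * (1 - a)); first exact: mulr_gt0.
rewrite (_ : _ - _ = (x - e *: (a *: y + (1 - a) *: z)) + (e * a) *: y).
  by apply/coneD/coneZ => //; rewrite mulr_ge0 // ltW.
by rewrite scalerDr !scalerA opprD addrA addrAC subrK.
Qed.

Lemma gen_face_trans x y : K x -> gen_face x y -> gen_face y `<=` gen_face x.
Proof. by move=> Kx Gy; apply: gen_face_min Gy; apply: gen_face_face. Qed.

Lemma dim_gen_face_lt x x' y : K x -> gen_face x x' -> gen_face x y ->
  ~ gen_face x' y -> (\dim (lspan (gen_face x')) < \dim (lspan (gen_face x)))%N.
Proof.
move=> Kx Gx' Gy Ny; have Kx' : K x' by case: Gx'.
apply: dim_face_lt; try exact: gen_face_face.
  by exists x'; apply: gen_face_refl.
by split; [apply: gen_face_trans | move=> /(_ _ Gy)].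
Qed.

Lemma closed_line x y : closed [set t : R | K (x + t *: y)].
Proof.
have cf : continuous (fun t : R => x + t *: y).
  by move=> t; apply: cvgD; [exact: cvg_cst|exact: cvgZr_tmp].
by apply: (proj1 (continuous_closedP _) cf); case: hK.
Qed.

(** The t with x - t y in [K] form a closed set, and a bounded one since [K] is
    pointed; take the largest.  If [y] belonged to the face generated by the end
    point, one could move on. *)
Lemma max_step x y : K x -> K y -> y != 0 ->
  exists2 t : R, 0 <= t & K (x - t *: y) /\ ~ gen_face (x - t *: y) y.
Proof.
move=> Kx Ky y0; pose T := [set t : R | K (x - t *: y)].
have T0 : T 0 by rewrite /T /= scale0r subr0.
have Tdown (s t : R) : 0 < s -> s < t -> T t -> T s.
  move=> s0 st; apply: gen_face_shrink => //; first by rewrite !ltW.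
  exact: lt_trans st.
have Tbd : has_ubound T.
  (* otherwise s x - y lies in K for every s > 0, hence so does its limit - y *)
  apply: contrapT => nT.
  have T_all (s : R) : 0 < s -> K (- y + s *: x).
    move=> s0; have Ts : T s^-1.
      apply: contrapT => nTs; apply: nT; exists s^-1 => t Tt.
      rewrite leNgt; apply/negP => st; apply/nTs/(Tdown _ _ _ st Tt).
      by rewrite invr_gt0.
    have := coneZ (ltW s0) Ts; rewrite scalerBr scalerA divff ?gt_eqF //.
    by rewrite scale1r addrC.
  move/eqP: y0; apply; apply: cone_pointed => //.
  rewrite -[- y]addr0 -(scale0r x).
  suff : [set t : R | K (- y + t *: x)] 0 by [].
  apply: closed_line => B /nbhs_ballP[e /= e0 eB].
  exists (e / 2); split; first by apply: T_all; rewrite divr_gt0.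
  apply: eB; rewrite /ball /= sub0r normrN gtr0_norm ?divr_gt0 //.
  by rewrite ltr_pdivrMr // ltr_pMr // ltr1n.
have cT : closed T.
  have -> : T = [set t : R | K (x + t *: (- y))].
    by apply/seteqP; split=> t; rewrite /T /= scalerN.
  exact: closed_line.
have Tsup : T (sup T) by apply: cT; apply: closure_sup => //; exists 0.
have s0 : 0 <= sup T by apply: ub_le_sup.
exists (sup T) => //; split=> // -[_ [e e0 Ke]].
suff : sup T + e <= sup T by rewrite gerDl leNgt e0.
by apply: ub_le_sup => //; rewrite /T /= scalerDl opprD addrA.
Qed.

(** * Extreme rays, decompositions and chains of faces *)

Lemma gen_face_line_extreme x : K x -> x != 0 ->
  gen_face x `<=` [set` <[x]>%VS] -> extreme_ray K (gen_face x).
Proof.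
move=> Kx x0 Gl; have fG := gen_face_face Kx; have Gx := gen_face_refl Kx.
split=> //; rewrite aff_dimE; last by apply: (face0 fG); exists x.
exact: lspan_sub_line Gl.
Qed.

(** If the face generated by [x] is not a ray, a maximal step inside it reaches a
    nonzero point generating a face of smaller dimension. *)
Lemma exists_extreme_ray x : K x -> x != 0 ->
  exists2 d, gen_face x d & d != 0 /\ extreme_ray K (gen_face d).
Proof.
have [m] := ubnP (\dim (lspan (gen_face x))).
elim: m x => // m IHm x dm Kx x0.
have [Gl|] := pselect (gen_face x `<=` [set` <[x]>%VS]).
  by exists x; [exact: gen_face_refl | split=> //; exact: gen_face_line_extreme].
move=> /existsNP[y /not_implyP[Gy /= yx]].
have Ky : K y by case: Gy.
have y0 : y != 0 by apply: contra_notN yx => /eqP ->; rewrite mem0v.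
have [t t0 [Kx' Ny]] := max_step Kx Ky y0.
(* moving from x along - y to the boundary shrinks the face; the end point is
   not 0 because y is not a multiple of x *)
have x'0 : x - t *: y != 0.
  apply: contra_notN yx => /eqP /subr0_eq xE.
  have tn0 : t != 0 by apply: contra_neq x0 => tE; rewrite xE tE scale0r.
  by apply/vlineP; exists t^-1; rewrite xE scalerA mulVf ?scale1r.
have Gx' : gen_face x (x - t *: y).
  apply: (face_summand (gen_face_face Kx) _ Kx' (coneZ t0 Ky)).
    by exists y.
  by rewrite subrK; exact: gen_face_refl.
have [|d Gd dP] := IHm _ _ Kx' x'0.
  exact: leq_trans (dim_gen_face_lt Kx Gx' Gy Ny) _.
by exists d => //; exact: (gen_face_trans Kx Gx').
Qed.

Lemma sum_of_extremeS F d x k : extreme_ray K F -> F d -> sum_of_extreme K x k ->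
  sum_of_extreme K (d + x) k.+1.
Proof.
move=> eF Fd [f [fP ->]].
exists (fun i => if unlift ord0 i is Some j then f j else d); split.
  by move=> i; case: unlift => [j|]; [exact: fP | exists F].
rewrite big_ord_recl unlift_none; congr (_ + _).
by apply: eq_bigr => i _; rewrite liftK.
Qed.

(** Each greedy step removes one element of an extreme ray from [x] and adds one
    face on top of the chain of the remainder.  Prescribing the top face of the
    chain makes the induction go through. *)
Lemma extreme_decomposition_chain x : K x -> exists j (F : nat -> set 'rV[R]_n),
  [/\ sum_of_extreme K x j, face_chain K j.+1 F & F 0%N = gen_face x].
Proof.
have [m] := ubnP (\dim (lspan (gen_face x))).
elim: m x => // m IHm x dm Kx.
have Gnon z : K z -> gen_face z !=set0 by exists z; exact: gen_face_refl.
have [->|x0] := eqVneq x 0.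
  exists 0%N, (fun=> gen_face 0); split=> //.
    by exists (fun=> 0); split; [case|rewrite big_ord0].
  split=> // i _; split; first exact/gen_face_face/cone0.
  exact/Gnon/cone0.
have [d Gd [d0 ed]] := exists_extreme_ray Kx x0.
have Kd : K d by case: Gd.
have [t t0 [Kx' Nd]] := max_step Kx Kd d0.
have fG := gen_face_face Kx.
have Gx' : gen_face x (x - t *: d).
  apply: (face_summand fG _ Kx' (coneZ t0 Kd)); first exact: Gnon.
  by rewrite subrK; exact: gen_face_refl.
have [|j [F [sj [cF1 cF2] FE]]] := IHm _ _ Kx'.
  exact: leq_trans (dim_gen_face_lt Kx Gx' Gd Nd) _.
exists j.+1, (fun i => if i is i'.+1 then F i' else gen_face x); split=> //.
  rewrite -(subrKC (t *: d) x); apply: sum_of_extremeS sj; first exact: ed.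
  by apply: gen_faceZ => //; exact: gen_face_refl.
split=> [[|i] ij|[|i] ij].
- by split=> //; exact: Gnon.
- exact: cF1.
- rewrite FE; split; first exact: gen_face_trans.
  by move=> /(_ _ Gd).
- exact: cF2.
Qed.

(** The dimension drops by at least one at each of the l - 1 - i steps that follow
    index i. *)
Lemma face_chain_dim l C i : face_chain K l C -> (i < l)%N ->
  (l <= \dim (lspan (C i)) + i.+1)%N.
Proof.
move=> [cC1 cC2] il; have [k] := ubnP (l - i); elim: k i il => // k IHk i il lk.
have [il'|] := ltnP i.+1 l; last by move=> h; apply: leq_trans h (leq_addl _ _).
have := IHk _ il' ltac:(lia).
have [fi ni] := cC1 _ il; have [fi' ni'] := cC1 _ il'.
have := dim_face_lt fi' ni' fi (cC2 _ il'); lia.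
Qed.

(** The decomposition of the witness [x] has at least m summands, so its chain has
    at least m + 1 faces and the bound on the chains is attained; the same bound
    applied to the chains of the other points bounds kappa. *)
Lemma kappa_longest_chain m :
  (forall l C, face_chain K l C -> (l <= m.+1)%N) ->
  (exists2 x, K x & forall j, sum_of_extreme K x j -> (m <= j)%N) ->
  is_kappa K m /\ is_longest_chain_length K m.+1.
Proof.
move=> chain_le [x Kx xm].
have kappa_ex z : K z -> exists2 k, is_kappa_at K z k & (k <= m)%N.
  move=> Kz; have [j [C [sj cC _]]] := extreme_decomposition_chain Kz.
  have sum_ex : exists j, `[< sum_of_extreme K z j >] by exists j; apply/asboolP.
  case: (ex_minnP sum_ex) => k /asboolP sk kmin.
  exists k; first by split=> // i /asboolP; apply: kmin.
  by apply: leq_trans (kmin _ (asboolT sj)) _; apply: chain_le cC.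
split; split=> //.
  exists x => //; have [k [sk kmin] km] := kappa_ex _ Kx.
  by have <- : k = m by apply: anti_leq; rewrite km xm.
have [j [C [sj [cC1 cC2] _]]] := extreme_decomposition_chain Kx.
have mj : (m < j.+1)%N by rewrite ltnS xm.
by exists C; split=> i im; [apply: cC1|apply: cC2]; apply: leq_trans mj.
Qed.

(** * Cones with countably many extreme rays *)

Lemma extreme_ray_line F : extreme_ray K F ->
  exists2 g : 'rV[R]_n, F g /\ g != 0 & F `<=` [set` <[g]>%VS].
Proof.
move=> [fF dF]; have F0 : F !=set0.
  apply: contrapT => /set0P/negP; rewrite negbK => /eqP FE.
  (* the empty set has no direction space, so its dimension is the default 0 *)
  move: dF; rewrite /aff_dim xgetPN ?dimv0 // => V [x0].
  rewrite (_ : affine_hull F = set0).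
    by move/seteqP => [_ /(_ x0)]; apply; exists 0; rewrite ?addr0 //= mem0v.
  by rewrite -subset0; apply: smallest_sub; [move=> ? ? ? []|rewrite FE].
move: dF; rewrite aff_dimE; last exact: (face0 fF).
have [X [XF fX XE]] := lspan_basis F.
rewrite XE (eqP fX); case: X XE fX XF => [|g [|//]] // XE fX XF _.
exists g; last by move=> y /mem_lspan; rewrite XE span_seq1.
by split; [apply: XF; rewrite inE | rewrite -seq1_free].
Qed.

Lemma extreme_ray_generators : countable [set F | extreme_ray K F] ->
  exists g : nat -> 'rV[R]_n,
    forall F d, extreme_ray K F -> F d -> exists i, d \in <[g i]>%VS.
Proof.
move=> /countable_injP[f finj].
pose g i := xget 0 [set v | exists2 F, extreme_ray K F /\ f F = i &
                        forall y, F y -> y \in <[v]>%VS].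
exists g => F d eF Fd; exists (f F).
have [v _ Fv] := extreme_ray_line eF.
have [F' [eF' fF'] F'g] : exists2 F', extreme_ray K F' /\ f F' = f F &
    forall y, F' y -> y \in <[g (f F)]>%VS.
  by apply: (@xgetI _ 0 [set v | exists2 F', extreme_ray K F' /\ f F' = f F &
                        forall y, F' y -> y \in <[v]>%VS] v); exists F.
by apply: F'g; rewrite (finj _ _ _ _ fF') ?inE.
Qed.

Lemma sum_of_extreme_span (g : nat -> 'rV[R]_n) x k :
  (forall F d, extreme_ray K F -> F d -> exists i, d \in <[g i]>%VS) ->
  sum_of_extreme K x k ->
  exists2 s : seq nat, size s = k & x \in <<[seq g i | i <- s]>>%VS.
Proof.
move=> gP [d [dP ->]].
have /choice[f fP] : forall i : 'I_k, exists j, d i \in <[g j]>%VS.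
  by move=> i; have [F eF Fd] := dP i; apply: gP Fd.
exists (codom f); first by rewrite size_codom card_ord.
apply: rpred_sum => i _; apply: subvP (fP i); rewrite -memvE.
by apply/memv_span/map_f/codom_f.
Qed.
End Cones.

Section MomentCurve.
Variables (R : realType) (n : nat).

Definition moment_curve (X : seq 'rV[R]_n) (t : R) : 'rV[R]_n :=
  \sum_(i < size X) t ^+ i *: X`_i.

Lemma finite_roots (p : {poly R}) : p != 0 -> finite_set [set t | root p t].
Proof.
move=> p0; apply: contrapT => /(@infinite_set_fset _ _ (size p))[B Bp sB].
move: sB; rewrite leqNgt => /negP; apply; apply: max_poly_roots => //.
  by apply/allP => t tB; apply: Bp.
exact: finmap.fset_uniq.
Qed.

(** The projection along [W] turns membership in [W] into the vanishing of a
    vector whose coordinates are polynomials in t.  They are not all zero, since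
    some entry of [X] is outside [W]. *)
Lemma moment_curve_countable X (W : {vspace 'rV[R]_n}) : free X ->
  (\dim W < size X)%N -> countable [set t | moment_curve X t \in W].
Proof.
move=> fX dW; pose q := (\1 - projv W)%VF.
have qE v : q v = v - projv W v by rewrite add_lfunE opp_lfunE id_lfunE.
have [j /negP XjW] : exists j : 'I_(size X), ~ X`_j \in W.
  apply/existsNP => XW; move: dW; rewrite ltnNge -(eqP fX); apply/negP/negPn.
  apply/dimvS/span_subvP => v /(nthP 0)[i iX <-]; exact: (XW (Ordinal iX)).
have [c qc] : exists c, q X`_j 0 c != 0.
  apply: contrapT => qc; move/negP: XjW; apply.
  have : q X`_j = 0.
    apply/rowP => c; rewrite mxE; apply/eqP/negPn/negP => h.
    by apply: qc; exists c.
  by rewrite qE => /subr0_eq ->; apply: memv_proj.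
(* coordinate c of q (moment_curve X t), as a polynomial in t *)
pose p := \poly_(i < size X) q X`_i 0 c.
have p0 : p != 0.
  apply: contra_neq qc => pE; have := coef_poly (size X) (fun i => q X`_i 0 c) j.
  by rewrite -/p pE coef0 ltn_ord.
apply: sub_countable (finite_set_countable (finite_roots p0)).
apply: subset_card_le => t /= tW; rewrite /root horner_poly.
have : q (moment_curve X t) = 0 by rewrite qE projv_id ?subrr.
rewrite linear_sum => /rowP/(_ c); rewrite summxE mxE => pt.
by apply/eqP; rewrite -[RHS]pt; apply: eq_bigr => i _; rewrite linearZ mxE mulrC.
Qed.

(** The exceptional parameters form a countable set, which has Lebesgue measure 0
    and so cannot contain the interval [0, 1]. *)
Lemma moment_curve_avoids X (J : countType) (D : set J)
    (W : J -> {vspace 'rV[R]_n}) :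
  free X -> (forall i, D i -> (\dim (W i) < size X)%N) ->
  exists2 t : R, 0 <= t & forall i, D i -> moment_curve X t \notin W i.
Proof.
move=> fX dW; apply: contrapT => nt.
have cU : countable (\bigcup_(i in D) [set t | moment_curve X t \in W i]).
  by apply: bigcup_countable => // i /dW; apply: moment_curve_countable.
have c01 : countable `[0%R : R, 1%R]%classic.
  apply: sub_countable cU; apply: subset_card_le => t /=.
  rewrite in_itv /= => /andP[t0 _]; apply: contrapT => tU; apply: nt.
  by exists t => // i Di; apply/negP => tW; apply: tU; exists i.
have := countable_lebesgue_measure0 c01.
rewrite lebesgue_measure_itv /= lte_fin ltr01 -EFinB subr0 => -[] /eqP.
by rewrite oner_eq0.
Qed.

End MomentCurve.

Section CountablyManyRays.
Variables (R : realType) (n : nat) (K : set 'rV[R]_n).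
Hypotheses (hK : closed_convex_cone K) (hp : pointed_cone K).

Lemma kappa_countable : countable [set F | extreme_ray K F] ->
  is_kappa K (aff_dim K) /\ is_longest_chain_length K (aff_dim K).+1.
Proof.
move=> cK; rewrite aff_dimE; last exact: cone0.
apply: kappa_longest_chain => //.
  move=> [|l] C cC; first exact: leq0n.
  apply: leq_trans (face_chain_dim hK cC (ltn0Sn _)) _.
  rewrite addn1 ltnS; apply/dimvS/lspanS.
  by have [[]] := (proj1 cC) 0%N isT.
have [g gP] := extreme_ray_generators hK cK.
have [X [XK fX XE]] := lspan_basis K; rewrite XE (eqP fX).
have [|t t0 tP] := @moment_curve_avoids R n X (seq nat)
    [set s | (size s < size X)%N] (fun s => <<[seq g i | i <- s]>>%VS) fX.
  by move=> s /= sX; apply: leq_ltn_trans (dim_span _) _; rewrite size_map.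
exists (moment_curve X t).
  apply: (big_ind K); [exact: cone0|exact: coneD|move=> i _].
  by apply/(coneZ hK)/XK/mem_nth => //; apply: exprn_ge0.
move=> j /(sum_of_extreme_span gP)[s sj xs]; rewrite leqNgt; apply/negP => jX.
by move/negP: (tP s ltac:(rewrite /= sj //)); apply.
Qed.


(** As [K] is a cone, the right-hand sides of the inequalities can be replaced by
    0.  Then y in [K] belongs to the face generated by x as soon as all
    inequalities tight at x are tight at y, so extreme rays with the same tight
    inequalities contain generators of each other. *)
Lemma countable_extreme_rays_polyhedral : polyhedral K ->
  countable [set F | extreme_ray K F].
Proof.
move=> [m [A [b KE]]]; pose l i (x : 'rV[R]_n) := (A *m x^T) i 0.
have lB i x y (e : R) : l i (x - e *: y) = l i x - e * l i y.
  by rewrite /l linearB linearZ /= mulmxBr -scalemxAr !mxE.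
have K_l x : K x <-> forall i, l i x <= b i 0 by rewrite KE.
have b0 i : 0 <= b i 0.
  by have /K_l/(_ i) := cone0 hK; rewrite /l trmx0 mulmx0 mxE.
have K_hom x : K x <-> forall i, l i x <= 0.
  split=> [Kx i|lx]; last by apply/K_l => i; exact: le_trans (lx i) (b0 i).
  rewrite leNgt; apply/negP => lx.
  have t0 : 0 <= (b i 0 + 1) / l i x by rewrite divr_ge0 ?(ltW lx) // addr_ge0.
  have /K_l/(_ i) := coneZ hK t0 Kx.
  rewrite /l linearZ /= -scalemxAr mxE -/(l i x) divfK ?gt_eqF //.
  by rewrite gerDl leNgt ltr01.
have active x y : K x -> K y -> (forall i, l i x = 0 -> l i y = 0) ->
    gen_face K x y.
  move=> Kx Ky xy; split=> //.
  (* any e <= |l i x| / |l i y| for all i with l i x <> 0 will do *)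
  pose M := 1 + \sum_i `|l i y| / `|l i x|.
  have M0 : 0 < M.
    by rewrite ltr_pwDl // sumr_ge0 // => i _; rewrite divr_ge0.
  exists M^-1; first by rewrite invr_gt0.
  apply/K_hom => i; rewrite lB subr_le0.
  have [lx0|lx0] := eqVneq (l i x) 0; first by rewrite (xy _ lx0) lx0 mulr0.
  have lx_lt0 : l i x < 0 by rewrite lt_neqAle lx0 (proj1 (K_hom x) Kx).
  rewrite ler_pdivlMl // -lerN2 -mulrN -(ltr0_norm lx_lt0).
  apply: le_trans (ler_norm _) _; rewrite normrN.
  rewrite -ler_pdivrMr ?normr_gt0 // /M (bigD1 i) //= addrCA lerDl.
  by rewrite addr_ge0 // sumr_ge0 // => j _; rewrite divr_ge0.
pose g (F : set 'rV[R]_n) := xget 0 [set v | F v /\ v != 0].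
have gP F : extreme_ray K F -> [/\ F (g F), K (g F) & F `<=` [set` <[g F]>%VS]].
  move=> eF; have [v Fv Fl] := extreme_ray_line hK eF.
  have [Fg g0] : F (g F) /\ g F != 0.
    by apply: (@xgetI _ 0 [set v | F v /\ v != 0] v).
  split=> //; first by have [[FK _ _] _] := eF; apply: FK.
  move=> y /Fl /=; have /Fl /= /vlineP[c gE] := Fg.
  move=> /vlineP[c' ->]; apply: rpredZ.
  have c0 : c != 0 by apply: contra_neq g0 => c0; rewrite gE c0 scale0r.
  by apply/vlineP; exists c^-1; rewrite gE scalerA mulVf ?scale1r.
pose f (F : set 'rV[R]_n) := [set i | l i (g F) == 0]%SET.
have f_sub F1 F2 : extreme_ray K F1 -> extreme_ray K F2 -> f F1 = f F2 ->
    F1 `<=` F2.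
  move=> eF1 eF2 fE y F1y.
  have [_ Kg1 F1l] := gP _ eF1; have [F2g Kg2 _] := gP _ eF2.
  have [F2f _] := eF2; have F20 : F2 !=set0 by exists (g F2).
  have F2g1 : F2 (g F1).
    apply: (gen_face_min hK F2f F2g); apply: active => // i /eqP li.
    by have : i \in f F1; [rewrite fE inE | rewrite inE => /eqP].
  have [[F1K _ _] _] := eF1.
  apply: (face_lspan hK F2f F20) (F1K _ F1y) _.
  by have /vlineP[c ->] := F1l _ F1y; rewrite rpredZ // mem_lspan.
apply/countable_injP; exists (fun F => pickle (f F)).
move=> F1 F2 /set_mem eF1 /set_mem eF2 /(pcan_inj pickleK) fE.
by apply/seteqP; split; apply: f_sub.
Qed.

End CountablyManyRays.

(** * Strictly convex cones *)

Lemma nbhs_segment (R : realType) (n : nat) (A : set 'rV[R]_n)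
    (x y : 'rV[R]_n) : nbhs x A ->
  exists2 e : R, 0 < e & A (x - e *: y).
Proof.
move=> xA.
have cf : (fun e : R => x - e *: y) e @[e --> (0 : R)] --> x.
  rewrite -[X in _ --> X]subr0 -(scale0r y).
  by apply: cvgB; [exact: cvg_cst|exact: cvgZr_tmp].
have /nbhs_ballP[e /= e0 eA] := cf _ xA.
exists (e / 2); first by rewrite divr_gt0.
apply: (eA (e / 2)); rewrite /ball /= sub0r normrN gtr0_norm ?divr_gt0 //.
by rewrite ltr_pdivrMr // ltr_pMr // ltr1n.
Qed.

Section StrictlyConvex.
Variables (R : realType) (n : nat) (K : set 'rV[R]_n).
Hypotheses (hS : strictly_convex_cone K).

Let hK : closed_convex_cone K. Proof. by case: hS. Qed.
Let hp : pointed_cone K. Proof. by case: hS. Qed.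

Lemma gen_face_interior p : interior K p -> K `<=` gen_face K p.
Proof. by move=> Ip y Ky; split=> //; apply: nbhs_segment. Qed.

(** Points x - e p with p in [K] stay in the affine hull of [K], which is its
    linear span. *)
Lemma gen_face_rel_interior x p : K p -> rel_interior K x -> gen_face K x p.
Proof.
move=> Kp [Kx /(nbhs_segment p)[e e0 xe]]; split=> //; exists e => //.
apply: xe; rewrite affine_hullE; last exact: cone0.
by rewrite /= rpredB ?rpredZ // mem_lspan.
Qed.

(** If a face contains a relative interior point y, it contains the interior
    point p, which belongs to the face generated by y, and hence all of [K].  So
    all points of a proper face are boundary points. *)
Lemma proper_face_line F : face K F -> ~ K `<=` F ->
  exists x : 'rV[R]_n, F `<=` [set` <[x]>%VS].
Proof.
move=> fF KF; have [FK _ _] := fF.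
have [_ _ [p Ip] sc] := hS; have Kp : K p := interior_subset Ip.
have Fbd y : F y -> rel_boundary K y.
  move=> Fy; split; first exact: FK.
  move=> /(gen_face_rel_interior Kp) /(gen_face_min hK fF Fy) Fp; apply: KF.
  exact: subset_trans (gen_face_interior Ip) (gen_face_min hK fF Fp).
have [[x [Fx x0]]|F0] := pselect (exists x, F x /\ x != 0); last first.
  exists 0 => y Fy /=; have -> : y = 0; last exact: mem0v.
  by apply/eqP/negPn/negP => y0; apply: F0; exists y.
exists x => y Fy /=; apply/negPn/negP => yx; apply: KF.
rewrite -(sc x y) //; [|exact: Fbd|exact: Fbd|].
  by apply: smallest_sub => // z [] ->.
rewrite (perm_free (permEl (perm_catC [:: x] [:: y]))).
by rewrite free_cons span_seq1 yx seq1_free.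
Qed.

Lemma kappa_strictly_convex : (2 <= aff_dim K)%N ->
  is_kappa K 2 /\ is_longest_chain_length K 3.
Proof.
rewrite aff_dimE; last exact: cone0.
move=> dK; have not_line F x : K `<=` F -> F `<=` [set` <[x]>%VS] -> False.
  move=> KF Fx; have /(leq_trans dK) : (\dim (lspan K) <= \dim <[x]>)%N.
    by apply/dimvS/lspan_sub => y /KF/Fx.
  by rewrite dim_vline; case: eqP.
have [_ _ [p Ip] _] := hS; have Kp : K p := interior_subset Ip.
apply: kappa_longest_chain => //.
  move=> l C cC; have [l1|l1] := leqP l 1; first exact: leq_trans l1 _.
  apply: leq_trans (face_chain_dim hK cC l1) _; rewrite (leq_add2r 2 _ 1).
  have [cC1 cC2] := cC; have [C01 C10] := cC2 _ l1.
  have [[C0K _ _] _] := cC1 _ (ltnW l1); have [fC1 _] := cC1 _ l1.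
  have [x C1x] : exists x, C 1%N `<=` [set` <[x]>%VS].
    apply: proper_face_line => // KC1; apply: C10; exact: subset_trans KC1.
  by apply: leq_trans (dimvS (lspan_sub C1x)) _; rewrite dim_vline leq_b1.
exists p => // -[|[|//]] [d [dP pE]].
  exfalso; apply: (not_line K 0) => // y Ky.
  have [_ [e e0]] := gen_face_interior Ip Ky.
  rewrite pE big_ord0 sub0r => Ke.
  suff -> : y = 0 by rewrite /= mem0v.
  apply: (cone_pointed hp Ky); rewrite -[- y]scale1r -(mulVf (lt0r_neq0 e0)).
  by rewrite -scalerA scalerN; apply: coneZ => //; rewrite invr_ge0 ltW.
(* an extreme ray through p would contain the face K generated by p *)
exfalso; have [F eF] := dP ord0; rewrite big_ord1 in pE; rewrite -pE => Fp.
have [g _ Fg] := extreme_ray_line hK eF; have [fF _] := eF.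
apply: not_line Fg; apply: subset_trans (gen_face_interior Ip) _.
exact: gen_face_min Fp.
Qed.

End StrictlyConvex.

(** * The theorem *)

Theorem theorem7 (R : realType) (n : nat) (K : set 'rV[R]_n)
    (hK : closed_convex_cone K) (hp : pointed_cone K) :
  [/\ countable [set F | extreme_ray K F] ->
        exists k l : nat, [/\ is_kappa K k, is_longest_chain_length K l,
          k = (l - 1)%N & (l - 1)%N = aff_dim K],
      polyhedral K ->
        exists k l : nat, [/\ is_kappa K k, is_longest_chain_length K l,
          k = (l - 1)%N & (l - 1)%N = aff_dim K] &
      strictly_convex_cone K -> (2 <= aff_dim K)%N ->
        exists k l : nat, [/\ is_kappa K k, is_longest_chain_length K l,
          k = (l - 1)%N & (l - 1)%N = 2%N]].
Proof.
have countable_case : countable [set F | extreme_ray K F] ->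
    exists k l : nat, [/\ is_kappa K k, is_longest_chain_length K l,
      k = (l - 1)%N & (l - 1)%N = aff_dim K].
  move=> cK; have [kK lK] := kappa_countable hK hp cK.
  by exists (aff_dim K), (aff_dim K).+1; rewrite subn1.
split=> // [pK|sK dK].
  exact/countable_case/countable_extreme_rays_polyhedral.
by have [kK lK] := kappa_strictly_convex sK dK; exists 2%N, 3%N.
Qed.
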